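(* Let $(a_n)_{n\ge 1}$ with $a_n>0$ and $(b_n)_{n\ge1}$ with $b_n\in\mathbb{R}$ be bounded sequences. (a) If there exists $N_0\in\mathbb{N}$ such that $a_n\le 1$ and $b_n\le 0$ for all $n\ge N_0$, then there exists a subordinate solution $v=(v_n)_{n=1}^\infty$ at $x=2$, and $v\in\ell^\infty(\mathbb{N})$. (b) If, moreover, $b_n\le b_{n+1}$ and $a_n\le a_{n+1}$ for all $n\ge N_0$, and $\lim_{n\to\infty}b_n=0$, $\lim_{n\to\infty}a_n=1$, then (for a suitably normalized such $v$) there exist constants $C_1,C_2\in(0,\infty)$ such that for all $n\ge N_0$, $$C_1 n^{-1}e^{-\sum_{j=N_0}^n\Gamma_j}\le v_n\le C_2\, n\, e^{-\sum_{j=N_0}^n\Gamma_j},$$ where, for $n\ge N_0$, $\Gamma_n=\operatorname{arccosh}\frac{2-b_n}{2a_n}$.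
   Context: For $x\in\mathbb{R}$, an eigensolution at $x$ is any sequence $u=(u_n)_{n=1}^\infty$ satisfying $a_{n-1}u_{n-1}+b_nu_n+a_nu_{n+1}=xu_n$ for all $n\ge 2$. A nontrivial (not identically zero) eigensolution $v$ at $x$ is called subordinate if for every eigensolution $u$ at $x$ that is not a multiple of $v$, $$\lim_{N\to\infty}\frac{\sum_{n=1}^N|v_n|^2}{\sum_{n=1}^N|u_n|^2}=0.$$ Subordinate solutions, when they exist, are unique up to a nonzero scalar multiple. *)

(* Defs.v *)
(* Stdlib world: Stdlib's real numbers with Coquelicot. *)
From Stdlib Require Import Reals Lra Lia.
From Coquelicot Require Import Coquelicot.
Open Scope R_scope.

(* Sequences (s_n)_{n >= 1} are functions on nat whose value at 0 is irrelevant: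
   no definition below ever looks at index 0. *)

(* Solutions are complex valued; real solutions are those in the image of RtoC. *)
Definition eigensolution (a b : nat -> R) (x : R) (u : nat -> C) : Prop :=
  forall n : nat, (2 <= n)%nat ->
    (a (n - 1)%nat * u (n - 1)%nat + b n * u n + a n * u (n + 1)%nat = x * u n)%C.

Definition multiple_of (v u : nat -> C) : Prop :=
  exists c : C, forall n : nat, (1 <= n)%nat -> u n = (c * v n)%C.

Definition nontrivial (u : nat -> C) : Prop :=
  exists n : nat, (1 <= n)%nat /\ u n <> RtoC 0.

(* A solution u that is not a multiple of v is nonzero, so the denominator below
   vanishes for at most finitely many N. *)
Definition subordinate (a b : nat -> R) (x : R) (v : nat -> C) : Prop :=
  eigensolution a b x v /\ nontrivial v /\
  forall u : nat -> C, eigensolution a b x u -> ~ multiple_of v u ->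
    is_lim_seq (fun N : nat => sum_n_m (fun n => Cmod (v n) ^ 2) 1 N /
                               sum_n_m (fun n => Cmod (u n) ^ 2) 1 N) 0.

Definition bounded_real (s : nat -> R) : Prop :=
  exists M : R, forall n : nat, (1 <= n)%nat -> Rabs (s n) <= M.

Definition bounded_complex (s : nat -> C) : Prop :=
  exists M : R, forall n : nat, (1 <= n)%nat -> Cmod (s n) <= M.

(* Meaningful for y >= 1, where it is the nonnegative inverse of cosh. *)
Definition arccosh (y : R) : R := ln (y + sqrt (y ^ 2 - 1)).

Lemma arccosh_ge0 (y : R) : 1 <= y -> 0 <= arccosh y.
Proof.
intros Hy; unfold arccosh.
pose proof (sqrt_pos (y ^ 2 - 1)) as Hs.
rewrite <- ln_1; apply ln_le; lra.
Qed.

Lemma cosh_arccosh (y : R) : 1 <= y -> cosh (arccosh y) = y.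
Proof.
intros Hy; unfold cosh, arccosh.
pose proof (sqrt_pos (y ^ 2 - 1)) as Hs.
assert (Hq : sqrt (y ^ 2 - 1) * sqrt (y ^ 2 - 1) = y ^ 2 - 1)
  by (apply sqrt_sqrt; nra).
rewrite exp_Ropp, exp_ln by lra.
set (s := sqrt (y ^ 2 - 1)) in *.
replace (/ (y + s)) with (y - s); [lra|].
apply Rmult_eq_reg_r with (y + s); [|lra].
rewrite Rinv_l by lra; nra.
Qed.

Definition Gamma (a b : nat -> R) (n : nat) : R := arccosh ((2 - b n) / (2 * a n)).

(* Main.v *)
Require Import Defs.
From Stdlib Require Import Reals Arith Lra Lia Classical.
From Coquelicot Require Import Coquelicot.
Open Scope R_scope.

(** From [N0] on, the equation at energy 2 reads
    [flux (n + 1) - flux n = (2 - b (n + 1) - a n - a (n + 1)) * u (n + 1)], where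
    [flux n = a n * (u (n + 1) - u n)], and the bracket is nonnegative. A solution [u]
    that starts positive and increasing therefore has nondecreasing flux, and grows at
    least linearly ([growing_solution]). Reduction of order turns [u] into a second
    solution [v] with constant Casoratian [-1] against [u] and
    [0 < v n <= / flux a u n] ([recessive_solution]). In particular [v] is bounded. Every
    complex solution is a combination of [u] and [v]; unless it is a multiple of [v] it
    tends to infinity in modulus, so that [v] is subordinate ([bounded_subordinate]). Any
    other subordinate solution is a multiple of it ([subordinate_unique]).

    For the asymptotics, put [y n = exp (Gamma a b n)], the larger root of
    [a n * (y + / y) = 2 - b n]. Under the monotonicity assumptions [y n] and
    [a n * y n] are nonincreasing.

    Upper bound: a solution [u] whose first ratio is at least [y N0] keeps
    [u (n + 1) >= y n * u n] ([growing_ratio]), hence dominates the product of the [y j].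
    Its increments [flux a u k / a k] are at most [flux a u n / a N0] for [k <= n], so
    [u n] is at most a constant times [n * flux a u n] ([growing_le_flux]); this is where
    the factor [n] comes from. Then [v n <= / flux a u n] is at most a constant
    times [n] over the product.

    Lower bound: the relation [p n <= y n * p (n + 1)] for a nonnegative solution passes
    from [n + 1] to [n] ([slow_decay_backwards]). It holds for [p = v + e * u] at
    arbitrarily large indices because [p] is unbounded, hence at all indices, and
    [e -> 0] gives it for [v] ([recessive_ratio]). So [v] decays no faster than the
    inverse product. *)

(** * Eigensolutions and their Casoratians *)

Lemma eigensolution_succ (a b : nat -> R) (x : R) (f : nat -> C) :
  eigensolution a b x f <->
  forall n : nat, (1 <= n)%nat ->
    (a n * f n + b (S n) * f (S n) + a (S n) * f (S (S n)) = x * f (S n))%C.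
Proof.
split; intros H n Hn.
- specialize (H (S n) ltac:(lia)).
  now replace (S n - 1)%nat with n in H by lia;
    replace (S n + 1)%nat with (S (S n)) in H by lia.
- destruct n as [|n]; [lia|].
  replace (S n - 1)%nat with n by lia; replace (S n + 1)%nat with (S (S n)) by lia.
  apply H; lia.
Qed.

Definition real_eigensolution (a b : nat -> R) (x : R) (u : nat -> R) : Prop :=
  forall n : nat, (1 <= n)%nat ->
    a n * u n + b (S n) * u (S n) + a (S n) * u (S (S n)) = x * u (S n).

Lemma real_eigensolution_RtoC (a b : nat -> R) (x : R) (u : nat -> R) :
  real_eigensolution a b x u -> eigensolution a b x (fun n => RtoC (u n)).
Proof.
intros H; apply eigensolution_succ; intros n Hn.
rewrite <- !RtoC_mult, <- !RtoC_plus; f_equal; now apply H.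
Qed.

Fixpoint recurrence_from_1 (a b : nat -> R) (x p q : R) (n : nat) : R :=
  match n with
  | O => 0
  | S m =>
    match m with
    | O => p
    | S k =>
      match k with
      | O => q
      | S _ => ((x - b m) * recurrence_from_1 a b x p q m
                - a k * recurrence_from_1 a b x p q k) / a m
      end
    end
  end.

(** The recurrence can be run backwards as well because no [a n] vanishes; the
    induction on [N] performs one backward step at a time. *)
Lemma eigensolution_with_data (a b : nat -> R) (x : R)
  (ha : forall n : nat, (1 <= n)%nat -> 0 < a n) (N : nat) :
  (1 <= N)%nat -> forall p q : R,
  exists u, real_eigensolution a b x u /\ u N = p /\ u (S N) = q.
Proof.
induction N as [|N IH]; [lia|intros _ p q].
destruct (Nat.eq_dec N 0) as [->|HN].
- exists (recurrence_from_1 a b x p q); split; [|easy].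
  intros [|k] Hn; [lia|].
  pose proof (ha (S (S k)) ltac:(lia)).
  remember (S (S k)) as m eqn:Hm.
  assert (E : recurrence_from_1 a b x p q (S m)
              = ((x - b m) * recurrence_from_1 a b x p q m
                 - a (S k) * recurrence_from_1 a b x p q (S k)) / a m)
    by now rewrite Hm.
  rewrite E; field; lra.
- pose proof (ha N ltac:(lia)) as A0; pose proof (ha (S N) ltac:(lia)) as A1.
  destruct (IH ltac:(lia) (((x - b (S N)) * p - a (S N) * q) / a N) p)
    as (u & Hu & H0 & H1).
  exists u; split; [easy|split; [easy|]].
  specialize (Hu N ltac:(lia)); rewrite H0, H1 in Hu.
  apply Rmult_eq_reg_l with (a (S N)); [|lra].
  replace (a N * (((x - b (S N)) * p - a (S N) * q) / a N))
    with ((x - b (S N)) * p - a (S N) * q) in Hu by (field; lra).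
  lra.
Qed.

Definition casoratian (a : nat -> R) (f g : nat -> C) (n : nat) : C :=
  (a n * (f n * g (S n) - f (S n) * g n))%C.

Lemma casoratian_const (a b : nat -> R) (x : R) (f g : nat -> C) :
  eigensolution a b x f -> eigensolution a b x g ->
  forall n m : nat, (1 <= n)%nat -> (1 <= m)%nat ->
  casoratian a f g n = casoratian a f g m.
Proof.
intros Hf Hg.
rewrite eigensolution_succ in Hf, Hg.
assert (K : forall n, (1 <= n)%nat -> casoratian a f g n = casoratian a f g 1).
{ induction 1 as [|n Hn IH]; [easy|rewrite <- IH].
  specialize (Hf n Hn); specialize (Hg n Hn); unfold casoratian.
  transitivity (f (S n) * (a (S n) * g (S (S n))) - a (S n) * f (S (S n)) * g (S n))%C;
    [ring|].
  replace (a (S n) * g (S (S n)))%C with (x * g (S n) - a n * g n - b (S n) * g (S n))%C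
    by (rewrite <- Hg; ring).
  replace (a (S n) * f (S (S n)))%C with (x * f (S n) - a n * f n - b (S n) * f (S n))%C
    by (rewrite <- Hf; ring).
  ring. }
intros n m Hn Hm; now rewrite (K n Hn), (K m Hm).
Qed.

Lemma real_casoratian_const (a b : nat -> R) (x : R) (f g : nat -> R) :
  real_eigensolution a b x f -> real_eigensolution a b x g ->
  forall n m : nat, (1 <= n)%nat -> (1 <= m)%nat ->
  a n * (f n * g (S n) - f (S n) * g n) = a m * (f m * g (S m) - f (S m) * g m).
Proof.
intros Hf%real_eigensolution_RtoC Hg%real_eigensolution_RtoC n m Hn Hm.
pose proof (casoratian_const _ _ _ _ _ Hf Hg n m Hn Hm) as H.
unfold casoratian in H.
rewrite <- !RtoC_mult, <- !RtoC_minus, <- !RtoC_mult in H.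
now apply RtoC_inj.
Qed.

(** Cramer's rule: the coordinates of [w] in the basis [u], [v] are, up to the
    nonzero constant Casoratian of [u] and [v], Casoratians of [w] with [v] and [u]. *)
Lemma eigensolution_decompose (a b : nat -> R) (x : R) (u v w : nat -> C) :
  eigensolution a b x u -> eigensolution a b x v -> eigensolution a b x w ->
  casoratian a u v 1 <> RtoC 0 ->
  exists al be : C, forall n : nat, (1 <= n)%nat -> w n = (al * u n + be * v n)%C.
Proof.
intros Hu Hv Hw H0.
exists (casoratian a w v 1 / casoratian a u v 1)%C,
       (casoratian a u w 1 / casoratian a u v 1)%C.
intros n Hn.
assert (E : (casoratian a u v 1 * w n
             = casoratian a w v 1 * u n + casoratian a u w 1 * v n)%C).
{ rewrite (casoratian_const _ _ _ _ _ Hu Hv 1 n), (casoratian_const _ _ _ _ _ Hw Hv 1 n),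
    (casoratian_const _ _ _ _ _ Hu Hw 1 n) by lia.
  unfold casoratian; ring. }
transitivity ((casoratian a u v 1 * w n) / casoratian a u v 1)%C; [now field|].
rewrite E; now field.
Qed.

(** * Subordinacy *)

Lemma ratio_of_sums_0 (f g : nat -> R) (M : R) :
  (forall n, (1 <= n)%nat -> 0 <= f n <= M) ->
  (forall n, 0 <= g n) ->
  is_lim_seq g p_infty ->
  is_lim_seq (fun N => sum_n_m f 1 N / sum_n_m g 1 N) 0.
Proof.
intros Hf Hg Hlim.
assert (HM : 0 <= M) by (destruct (Hf 1%nat (le_n _)); lra).
assert (HF : forall N, 0 <= sum_n_m f 1 N <= M * INR N).
{ induction N as [|N IH].
  - rewrite sum_n_m_zero by lia; simpl; unfold zero; simpl; lra.
  - rewrite sum_n_Sm by lia; rewrite S_INR; unfold plus; simpl.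
    pose proof (Hf (S N) ltac:(lia)); lra. }
apply is_lim_seq_spec; intros [eps Heps]; simpl.
set (K := 2 * (M + 1) / eps).
assert (HK : 0 < K) by (apply Rdiv_lt_0_compat; lra).
apply is_lim_seq_spec in Hlim.
destruct (Hlim K) as [n1 Hn1].
assert (HG : forall N, 0 <= sum_n_m g 1 N /\ K * (INR N - INR n1) <= sum_n_m g 1 N).
{ induction N as [|N IH].
  - rewrite sum_n_m_zero by lia; unfold zero; simpl.
    pose proof (pos_INR n1); split; nra.
  - rewrite sum_n_Sm by lia.
    change (0 <= sum_n_m g 1 N + g (S N) /\
            K * (INR (S N) - INR n1) <= sum_n_m g 1 N + g (S N)).
    pose proof (Hg (S N)).
    split; [lra|].
    destruct (le_lt_dec n1 (S N)) as [Hle|Hlt].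
    + pose proof (Hn1 _ Hle); rewrite S_INR; nra.
    + apply lt_INR in Hlt; nra. }
(* From here on, at least half of the first [N] indices lie beyond [n1]. *)
exists (2 * n1 + 1)%nat; intros N HN.
specialize (HF N); specialize (HG N).
apply le_INR in HN; rewrite plus_INR, mult_INR in HN; simpl in HN.
pose proof (pos_INR n1).
assert (HGN : K * INR N / 2 <= sum_n_m g 1 N) by nra.
assert (HGpos : 0 < sum_n_m g 1 N) by nra.
rewrite Rminus_0_r, Rabs_pos_eq by (apply Rdiv_le_0_compat; lra).
apply Rmult_lt_reg_r with (sum_n_m g 1 N); [easy|].
unfold Rdiv; rewrite Rmult_assoc, Rinv_l, Rmult_1_r by lra.
assert (HKe : eps * K = 2 * (M + 1)) by (unfold K; field; lra).
apply Rlt_le_trans with (eps * (K * INR N / 2)); [nra|].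
apply Rmult_le_compat_l; lra.
Qed.

(** In the basis of a bounded solution [v] and an unbounded one [u], every solution
    that is not a multiple of [v] has a nonzero [u]-component and so tends to infinity
    in modulus. *)
Lemma bounded_subordinate (a b : nat -> R) (x : R) (u v : nat -> R) :
  real_eigensolution a b x u -> real_eigensolution a b x v ->
  casoratian a (fun n => RtoC (u n)) (fun n => RtoC (v n)) 1 <> RtoC 0 ->
  nontrivial (fun n => RtoC (v n)) ->
  bounded_complex (fun n => RtoC (v n)) ->
  is_lim_seq u p_infty ->
  subordinate a b x (fun n => RtoC (v n)).
Proof.
intros Hu Hv H0 Hnt [M HM] Hlim.
apply real_eigensolution_RtoC in Hu, Hv.
split; [easy|split; [easy|]]; intros w Hw Hnm.
destruct (eigensolution_decompose _ _ _ _ _ _ Hu Hv Hw H0) as (al & be & E).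
assert (Hal : al <> RtoC 0).
{ intros ->; apply Hnm; exists be; intros n Hn; rewrite E by easy; ring. }
assert (HM0 : 0 <= M) by (pose proof (HM 1%nat (le_n _)); pose proof (Cmod_ge_0 (v 1%nat)); lra).
apply ratio_of_sums_0 with (M := M ^ 2).
- intros n Hn; specialize (HM n Hn); pose proof (Cmod_ge_0 (v n)).
  split; [apply pow_le; lra|apply pow_incr; lra].
- intros n; apply pow_le, Cmod_ge_0.
- apply Cmod_gt_0 in Hal; pose proof (Cmod_ge_0 be).
  apply is_lim_seq_spec; intros K.
  apply is_lim_seq_spec in Hlim.
  destruct (Hlim ((Rabs K + 1 + Cmod be * M) / Cmod al)) as [n1 Hn1].
  exists (S n1); intros n Hn.
  specialize (Hn1 n ltac:(lia)).
  apply Rmult_lt_compat_r with (r := Cmod al) in Hn1; [|easy].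
  unfold Rdiv in Hn1; rewrite Rmult_assoc, Rinv_l, Rmult_1_r in Hn1 by lra.
  assert (T : Cmod al * Cmod (u n) <= Cmod (w n) + Cmod be * Cmod (v n)).
  { rewrite <- !Cmod_mult.
    replace (al * u n)%C with (w n + - (be * v n))%C by (rewrite E by lia; ring).
    eapply Rle_trans; [apply Cmod_triangle|rewrite Cmod_opp; lra]. }
  specialize (HM n ltac:(lia)).
  rewrite (Cmod_R (u n)) in T; pose proof (Rle_abs (u n)).
  pose proof (Rle_abs K); pose proof (Rabs_pos K).
  assert (Rabs K + 1 < Cmod (w n)) by nra.
  nra.
Qed.

(** If neither solution were a multiple of the other, the ratio of their square sums
    and its inverse would both tend to 0. *)
Lemma subordinate_unique (a b : nat -> R) (x : R) (v w : nat -> C) :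
  subordinate a b x v -> subordinate a b x w ->
  exists c : C, c <> RtoC 0 /\ forall n : nat, (1 <= n)%nat -> w n = (c * v n)%C.
Proof.
intros (Ev & Nv & Sv) (Ew & Nw & Sw).
assert (D : multiple_of v w).
{ apply NNPP; intros Hvw.
  assert (Hwv : ~ multiple_of w v).
  { intros [c Hc]; apply Hvw; exists (/ c)%C; intros n Hn.
    assert (c <> RtoC 0).
    { intros ->; destruct Nv as (k & Hk & Hk0); apply Hk0; rewrite Hc by easy; ring. }
    rewrite (Hc n Hn); now field. }
  pose proof (is_lim_seq_mult' _ _ _ _ (Sv w Ew Hvw) (Sw v Ev Hwv)) as L.
  assert (P : forall f : nat -> C, nontrivial f ->
    exists k, forall N, (k <= N)%nat -> 0 < sum_n_m (fun n => Cmod (f n) ^ 2) 1 N).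
  { intros f (k & Hk & Hk0); exists k; induction 1 as [|N HN IH].
    - destruct k as [|k]; [lia|]; rewrite sum_n_Sm by lia.
      apply Rplus_le_lt_0_compat; [|apply pow_lt; now apply Cmod_gt_0].
      clear; induction k as [|k IH].
      + rewrite sum_n_m_zero by lia; apply Rle_refl.
      + rewrite sum_n_Sm by lia; apply Rplus_le_le_0_compat; [easy|].
        apply pow_le, Cmod_ge_0.
    - rewrite sum_n_Sm by lia.
      apply Rplus_lt_le_0_compat; [easy|apply pow_le, Cmod_ge_0]. }
  destruct (P v Nv) as [k Hk], (P w Nw) as [l Hl].
  apply (is_lim_seq_ext_loc _ (fun _ => 1)) in L.
  - apply is_lim_seq_unique in L; rewrite Lim_seq_const in L.
    injection L; lra.
  - exists (k + l)%nat; intros N HN.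
    specialize (Hk N ltac:(lia)); specialize (Hl N ltac:(lia)); field; lra. }
destruct D as [c Hc]; exists c; split; [|easy].
intros ->; destruct Nw as (k & Hk & Hk0); apply Hk0; rewrite Hc by easy; ring.
Qed.

(** * The growing solution *)

Definition flux (a u : nat -> R) (n : nat) : R := a n * (u (S n) - u n).

(** By the equation, the difference of the two sides is
    [(2 - b (S n) - a (S n) - a n) * u (S n)]. *)
Lemma flux_increasing (a b u : nat -> R) (n : nat) :
  real_eigensolution a b 2 u -> (1 <= n)%nat ->
  a n <= 1 -> a (S n) <= 1 -> b (S n) <= 0 -> 0 <= u (S n) ->
  flux a u n <= flux a u (S n).
Proof.
intros Hu Hn H1 H2 H3 H4; specialize (Hu n Hn); unfold flux.
assert (0 <= (2 - b (S n) - a (S n) - a n) * u (S n)) by (apply Rmult_le_pos; lra).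
nra.
Qed.

Lemma growing_solution (a b u : nat -> R) (N0 : nat)
  (ha : forall n : nat, (1 <= n)%nat -> 0 < a n) (hN0 : (1 <= N0)%nat)
  (hab : forall n : nat, (N0 <= n)%nat -> a n <= 1 /\ b n <= 0) :
  real_eigensolution a b 2 u -> u N0 = 1 -> 2 <= u (S N0) ->
  forall n : nat, (N0 <= n)%nat ->
  1 <= u n /\ a N0 <= flux a u n <= flux a u (S n) /\ u n + a N0 <= u (S n).
Proof.
intros Hu H0 H1.
pose proof (ha N0 hN0) as HaN.
assert (Hstep : forall n, (N0 <= n)%nat -> a N0 <= flux a u n -> u n + a N0 <= u (S n)).
{ intros n Hn Hf; pose proof (ha n ltac:(lia)); destruct (hab n Hn); unfold flux in Hf.
  assert (0 < u (S n) - u n) by nra; nra. }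
assert (Hup : forall n, (N0 <= n)%nat -> 0 <= u (S n) -> flux a u n <= flux a u (S n)).
{ intros n Hn Hp; destruct (hab n Hn), (hab (S n) ltac:(lia)).
  apply (flux_increasing a b); auto; lia. }
induction 1 as [|n Hn (I1 & I2 & I3)].
- assert (F : a N0 <= flux a u N0) by (unfold flux; nra).
  repeat split; try lra; [apply Hup; [lia|lra]|apply Hstep; [lia|easy]].
- assert (F : a N0 <= flux a u (S n)) by lra.
  pose proof (Hstep (S n) ltac:(lia) F).
  repeat split; try lra; apply Hup; [lia|lra].
Qed.

Lemma growing_solution_lim (u : nat -> R) (N0 : nat) (d : R) :
  0 < d -> (forall n : nat, (N0 <= n)%nat -> u n + d <= u (S n)) ->
  is_lim_seq u p_infty.
Proof.
intros Hd H.
assert (L : forall n, (N0 <= n)%nat -> u N0 + (INR n - INR N0) * d <= u n).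
{ induction 1 as [|n Hn IH]; [lra|]; specialize (H n Hn); rewrite S_INR; nra. }
apply is_lim_seq_spec; intros K.
destruct (nfloor_ex (Rabs ((K - u N0) / d))) as [m [_ Hm]]; [apply Rabs_pos|].
exists (m + N0 + 1)%nat; intros n Hn.
specialize (L n ltac:(lia)).
apply le_INR in Hn; rewrite !plus_INR in Hn; simpl in Hn.
pose proof (Rle_abs ((K - u N0) / d)).
assert ((K - u N0) / d * d < (INR n - INR N0) * d) by (apply Rmult_lt_compat_r; lra).
replace ((K - u N0) / d * d) with (K - u N0) in * by (field; lra).
lra.
Qed.

(** * The recessive solution *)

(** Reduction of order. For a second solution [g] with Casoratian 1 against [u], the
    quotients [g n / u n] increase, with increments [1 / (a n * u n * u (S n))]. As
    [flux a u] is nondecreasing, these are at most [(1 / u n - 1 / u (S n)) / flux a u k]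
    from index [k] on, and the right-hand side telescopes. Thus [g / u] has a supremum
    [L], and [L * u - g] is the recessive solution. *)
Lemma recessive_solution (a b u : nat -> R) (N0 : nat)
  (ha : forall n : nat, (1 <= n)%nat -> 0 < a n) (hN0 : (1 <= N0)%nat) :
  real_eigensolution a b 2 u ->
  (forall n : nat, (N0 <= n)%nat -> 0 < u n /\ 0 < flux a u n <= flux a u (S n)) ->
  exists v : nat -> R, real_eigensolution a b 2 v /\
    (forall n : nat, (1 <= n)%nat -> a n * (u n * v (S n) - u (S n) * v n) = -1) /\
    forall n : nat, (N0 <= n)%nat -> 0 < v n <= / flux a u n.
Proof.
intros Hu Hpos.
pose proof (ha N0 hN0) as HaN; destruct (Hpos N0 (le_n _)) as [HuN _].
destruct (eigensolution_with_data a b 2 ha N0 hN0 0 (/ (a N0 * u N0)))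
  as (g & Hg & Hg0 & Hg1).
assert (Cas : forall n, (1 <= n)%nat -> a n * (u n * g (S n) - u (S n) * g n) = 1).
{ intros n Hn; rewrite (real_casoratian_const _ _ _ _ _ Hu Hg n N0) by easy.
  rewrite Hg0, Hg1; field; lra. }
assert (Hinc : forall n, (N0 <= n)%nat ->
          g (S n) / u (S n) = g n / u n + / (a n * u n * u (S n))).
{ intros n Hn; destruct (Hpos n Hn) as [U1 _], (Hpos (S n) ltac:(lia)) as [U2 _].
  pose proof (ha n ltac:(lia)); specialize (Cas n ltac:(lia)).
  replace (g (S n)) with ((/ a n + u (S n) * g n) / u n).
  - field; lra.
  - apply Rmult_eq_reg_l with (a n * u n); [|nra].
    replace (a n * u n * ((/ a n + u (S n) * g n) / u n))
      with (1 + a n * (u (S n) * g n)) by (field; lra).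
    lra. }
assert (Hmono : forall n m, (N0 <= n)%nat -> (n <= m)%nat -> g n / u n <= g m / u m).
{ intros n m Hn; induction 1 as [|m Hm IH]; [lra|].
  destruct (Hpos m ltac:(lia)) as [U1 _], (Hpos (S m) ltac:(lia)) as [U2 _].
  pose proof (ha m ltac:(lia)); rewrite Hinc by lia.
  assert (0 < / (a m * u m * u (S m)))
    by (apply Rinv_0_lt_compat; repeat apply Rmult_lt_0_compat; easy).
  lra. }
assert (Hflux : forall n m, (N0 <= n)%nat -> (n <= m)%nat -> flux a u n <= flux a u m).
{ intros n m Hn; induction 1 as [|m Hm IH]; [lra|].
  destruct (Hpos m ltac:(lia)); lra. }
assert (Htel : forall n m, (N0 <= n)%nat -> (n <= m)%nat ->
          g m / u m + / (flux a u n * u m) <= g n / u n + / (flux a u n * u n)).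
{ intros n m Hn; induction 1 as [|m Hm IH]; [lra|].
  eapply Rle_trans; [|exact IH].
  destruct (Hpos m ltac:(lia)) as [U1 _], (Hpos (S m) ltac:(lia)) as [U2 _].
  destruct (Hpos n Hn) as [_ Fn].
  pose proof (ha m ltac:(lia)); specialize (Hflux n m Hn Hm); rewrite Hinc by lia.
  assert (0 <= (flux a u m - flux a u n) * / (flux a u n * (a m * u m * u (S m)))).
  { apply Rmult_le_pos; [lra|left; apply Rinv_0_lt_compat].
    apply Rmult_lt_0_compat; [lra|]; repeat apply Rmult_lt_0_compat; lra. }
  replace (/ (flux a u n * u m)) with
    (/ (a m * u m * u (S m)) + / (flux a u n * u (S m)) +
     (flux a u m - flux a u n) * / (flux a u n * (a m * u m * u (S m)))); [lra|].
  unfold flux at 2; field; repeat split; lra. }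
assert (Hub : forall n, (N0 <= n)%nat -> forall m, (N0 <= m)%nat ->
          g m / u m <= g n / u n + / (flux a u n * u n)).
{ intros n Hn m Hm; destruct (Hpos n Hn) as [Un Fn], (Hpos m Hm) as [Um _].
  destruct (le_lt_dec n m) as [Hle|Hlt].
  - specialize (Htel n m Hn Hle).
    assert (0 < / (flux a u n * u m))
      by (apply Rinv_0_lt_compat, Rmult_lt_0_compat; lra).
    lra.
  - pose proof (Hmono m n Hm ltac:(lia)).
    assert (0 < / (flux a u n * u n))
      by (apply Rinv_0_lt_compat, Rmult_lt_0_compat; lra).
    lra. }
destruct (completeness (fun y => exists m, (N0 <= m)%nat /\ y = g m / u m))
  as [L [HL1 HL2]].
{ eexists; intros y (m & Hm & ->); apply (Hub N0 (le_n _) m Hm). }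
{ eexists; exists N0; split; [lia|reflexivity]. }
exists (fun n => L * u n - g n); split; [|split].
- intros n Hn; specialize (Hu n Hn); specialize (Hg n Hn).
  transitivity (L * (a n * u n + b (S n) * u (S n) + a (S n) * u (S (S n)))
                - (a n * g n + b (S n) * g (S n) + a (S n) * g (S (S n)))); [ring|].
  rewrite Hu, Hg; ring.
- intros n Hn; specialize (Cas n Hn); lra.
- intros n Hn; destruct (Hpos n Hn) as [Un Fn].
  assert (A1 : g n / u n < L).
  { apply Rlt_le_trans with (g (S n) / u (S n)).
    - destruct (Hpos (S n) ltac:(lia)) as [U2 _]; pose proof (ha n ltac:(lia)).
      rewrite Hinc by easy.
      assert (0 < / (a n * u n * u (S n)))
        by (apply Rinv_0_lt_compat; repeat apply Rmult_lt_0_compat; easy).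
      lra.
    - apply HL1; exists (S n); split; [lia|reflexivity]. }
  assert (A2 : L <= g n / u n + / (flux a u n * u n))
    by (apply HL2; intros y (m & Hm & ->); now apply Hub).
  apply Rmult_lt_compat_r with (r := u n) in A1; [|easy].
  apply Rmult_le_compat_r with (r := u n) in A2; [|lra].
  replace (g n / u n * u n) with (g n) in A1 by (field; lra).
  replace ((g n / u n + / (flux a u n * u n)) * u n)
    with (g n + / flux a u n) in A2 by (field; lra).
  lra.
Qed.

Lemma eventually_bounded (v : nat -> C) (N0 : nat) (M : R) :
  (forall n : nat, (N0 <= n)%nat -> Cmod (v n) <= M) -> bounded_complex v.
Proof.
revert M; induction N0 as [|N IH]; intros M H.
- exists M; intros n _; apply H; lia.
- apply (IH (Rmax M (Cmod (v N)))); intros n Hn.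
  destruct (Nat.eq_dec n N) as [->|Hne]; [apply Rmax_r|].
  eapply Rle_trans; [apply H; lia|apply Rmax_l].
Qed.

(** The initial ratio [q] is left free because the lower bound on [u] by a product of
    local ratios needs [q] to exceed the first of them. *)
Lemma growing_recessive_pair (a b : nat -> R) (N0 : nat)
  (ha : forall n : nat, (1 <= n)%nat -> 0 < a n) (hN0 : (1 <= N0)%nat)
  (hab : forall n : nat, (N0 <= n)%nat -> a n <= 1 /\ b n <= 0) (q : R) :
  2 <= q ->
  exists u v : nat -> R,
    real_eigensolution a b 2 u /\ real_eigensolution a b 2 v /\
    u N0 = 1 /\ u (S N0) = q /\
    (forall n : nat, (N0 <= n)%nat ->
       1 <= u n /\ a N0 <= flux a u n <= flux a u (S n) /\ u n + a N0 <= u (S n)) /\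
    (forall n : nat, (N0 <= n)%nat -> 0 < v n <= / flux a u n) /\
    bounded_complex (fun n => RtoC (v n)) /\
    subordinate a b 2 (fun n => RtoC (v n)).
Proof.
intros Hq.
pose proof (ha N0 hN0) as HaN.
destruct (eigensolution_with_data a b 2 ha N0 hN0 1 q) as (u & Hu & Hu0 & Hu1).
pose proof (growing_solution a b u N0 ha hN0 hab Hu Hu0 ltac:(lra)) as Gr.
destruct (recessive_solution a b u N0 ha hN0 Hu) as (v & Hv & Cas & Hvn).
{ intros n Hn; destruct (Gr n Hn) as (G1 & G2 & _); lra. }
assert (Hbd : bounded_complex (fun n => RtoC (v n))).
{ apply eventually_bounded with N0 (/ a N0); intros n Hn.
  destruct (Hvn n Hn); destruct (Gr n Hn) as (_ & G2 & _).
  rewrite Cmod_R, Rabs_pos_eq by lra.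
  eapply Rle_trans; [eassumption|apply Rinv_le_contravar; lra]. }
exists u, v; do 7 (split; [easy|]).
apply bounded_subordinate with u; try easy.
- unfold casoratian; rewrite <- !RtoC_mult, <- RtoC_minus, <- RtoC_mult, Cas by lia.
  intros E%RtoC_inj; lra.
- exists N0; split; [easy|intros E%RtoC_inj].
  destruct (Hvn N0 (le_n _)); lra.
- apply growing_solution_lim with N0 (a N0); [easy|].
  intros n Hn; now destruct (Gr n Hn).
Qed.

(** * Comparison with the products of the local exponents *)

Lemma exp_Gamma (a b : nat -> R) (n : nat) :
  0 < a n <= 1 -> b n <= 0 ->
  a n * exp (Gamma a b n) = (2 - b n) / 2 + sqrt (((2 - b n) / 2) ^ 2 - a n ^ 2).
Proof.
intros Ha Hb; unfold Gamma, arccosh.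
set (c := (2 - b n) / (2 * a n)).
assert (Hc : a n * c = (2 - b n) / 2) by (unfold c; field; lra).
assert (1 <= c) by nra.
rewrite exp_ln by (pose proof (sqrt_pos (c ^ 2 - 1)); lra).
rewrite <- Hc, Rmult_plus_distr_l; f_equal.
replace ((a n * c) ^ 2 - a n ^ 2) with (a n ^ 2 * (c ^ 2 - 1)) by ring.
rewrite sqrt_mult by nra; rewrite sqrt_pow2; lra.
Qed.

Lemma exp_Gamma_ge1 (a b : nat -> R) (n : nat) :
  0 < a n <= 1 -> b n <= 0 -> 1 <= exp (Gamma a b n).
Proof.
intros Ha Hb; rewrite <- exp_0.
assert (0 <= Gamma a b n) as [H|<-];
  [apply arccosh_ge0|now left; apply exp_increasing|lra].
apply Rmult_le_reg_r with (2 * a n); [lra|].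
unfold Rdiv; rewrite Rmult_assoc, Rinv_l; lra.
Qed.

Lemma exp_Gamma_char (a b : nat -> R) (n : nat) :
  0 < a n <= 1 -> b n <= 0 ->
  2 - b n = a n * exp (Gamma a b n) + a n * / exp (Gamma a b n).
Proof.
intros Ha Hb.
assert (Hc : 1 <= (2 - b n) / (2 * a n)).
{ apply Rmult_le_reg_r with (2 * a n); [lra|].
  unfold Rdiv; rewrite Rmult_assoc, Rinv_l; lra. }
pose proof (cosh_arccosh _ Hc) as E.
fold (Gamma a b n) in E; unfold cosh in E; rewrite exp_Ropp in E.
apply Rmult_eq_compat_r with (r := 2 * a n) in E.
replace ((2 - b n) / (2 * a n) * (2 * a n)) with (2 - b n) in E by (field; lra).
lra.
Qed.

Lemma exp_Gamma_decreasing (a b : nat -> R) (n : nat) :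
  0 < a n <= 1 -> b n <= 0 -> 0 < a (S n) <= 1 -> b (S n) <= 0 ->
  b n <= b (S n) -> a n <= a (S n) ->
  a (S n) * exp (Gamma a b (S n)) <= a n * exp (Gamma a b n) /\
  exp (Gamma a b (S n)) <= exp (Gamma a b n).
Proof.
intros A1 B1 A2 B2 Hb Ha.
assert (Z : a (S n) * exp (Gamma a b (S n)) <= a n * exp (Gamma a b n)).
{ rewrite !exp_Gamma by easy.
  apply Rplus_le_compat; [lra|apply sqrt_le_1_alt; nra]. }
split; [easy|].
pose proof (exp_pos (Gamma a b (S n))); nra.
Qed.

(** The ratio [exp (Gamma a b n)] solves [a n * (y + / y) = 2 - b n]. Since it is
    nonincreasing and [a] is nondecreasing, a solution that has once grown at this rate keeps doing so. *)
Lemma growing_ratio (a b u : nat -> R) (N0 : nat)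
  (ha : forall n : nat, (1 <= n)%nat -> 0 < a n) (hN0 : (1 <= N0)%nat)
  (hab : forall n : nat, (N0 <= n)%nat -> a n <= 1 /\ b n <= 0)
  (hmono : forall n : nat, (N0 <= n)%nat -> b n <= b (S n) /\ a n <= a (S n)) :
  real_eigensolution a b 2 u ->
  (forall n : nat, (N0 <= n)%nat -> 0 <= u n) ->
  exp (Gamma a b N0) * u N0 <= u (S N0) ->
  forall n : nat, (N0 <= n)%nat -> exp (Gamma a b n) * u n <= u (S n).
Proof.
intros Hu Hp H0; induction 1 as [|n Hn IH]; [easy|].
specialize (Hu n ltac:(lia)).
pose proof (ha n ltac:(lia)); pose proof (ha (S n) ltac:(lia)).
destruct (hab n Hn), (hab (S n) ltac:(lia)), (hmono n Hn).
destruct (exp_Gamma_decreasing a b n) as [_ Y]; try lra.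
pose proof (exp_Gamma_char a b (S n) ltac:(lra) ltac:(lra)) as E.
pose proof (exp_pos (Gamma a b n)); pose proof (exp_pos (Gamma a b (S n))) as Y0.
set (y := exp (Gamma a b (S n))) in *.
pose proof (Hp n Hn); pose proof (Hp (S n) ltac:(lia)).
assert (Hun : u n <= / y * u (S n)).
{ apply Rmult_le_reg_l with y; [easy|].
  rewrite <- Rmult_assoc, Rinv_r, Rmult_1_l by lra.
  eapply Rle_trans; [|exact IH]; apply Rmult_le_compat_r; lra. }
apply Rmult_le_reg_l with (a (S n)); [easy|].
assert (a n * u n <= a (S n) * (/ y * u (S n))) by (apply Rmult_le_compat; lra).
replace (a (S n) * u (S (S n))) with ((2 - b (S n)) * u (S n) - a n * u n) by lra.
rewrite E; lra.
Qed.

(** In the backward direction, the property of decaying at most at rate [exp (Gamma a b n)] propagates: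
    here it is the monotonicity of [a n * exp (Gamma a b n)] that is used. *)
Lemma slow_decay_backwards (a b p : nat -> R) (N0 : nat)
  (ha : forall n : nat, (1 <= n)%nat -> 0 < a n) (hN0 : (1 <= N0)%nat)
  (hab : forall n : nat, (N0 <= n)%nat -> a n <= 1 /\ b n <= 0)
  (hmono : forall n : nat, (N0 <= n)%nat -> b n <= b (S n) /\ a n <= a (S n)) :
  real_eigensolution a b 2 p ->
  (forall n : nat, (N0 <= n)%nat -> 0 <= p n) ->
  forall k n : nat, (N0 <= n)%nat ->
  p (n + k)%nat <= exp (Gamma a b (n + k)) * p (S (n + k)) ->
  p n <= exp (Gamma a b n) * p (S n).
Proof.
intros Hp Hpos; induction k as [|k IH]; intros n Hn H.
- now rewrite Nat.add_0_r in H.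
- replace (n + S k)%nat with (S n + k)%nat in H by lia.
  apply IH in H; [|lia].
  specialize (Hp n ltac:(lia)).
  pose proof (ha n ltac:(lia)); pose proof (ha (S n) ltac:(lia)).
  destruct (hab n Hn), (hab (S n) ltac:(lia)), (hmono n Hn).
  destruct (exp_Gamma_decreasing a b n) as [Z _]; try lra.
  pose proof (exp_Gamma_char a b (S n) ltac:(lra) ltac:(lra)) as E.
  pose proof (exp_pos (Gamma a b (S n))) as Y0.
  set (y := exp (Gamma a b (S n))) in *.
  pose proof (Hpos (S n) ltac:(lia)).
  assert (/ y * p (S n) <= p (S (S n))).
  { apply Rmult_le_reg_l with y; [easy|].
    rewrite <- Rmult_assoc, Rinv_r, Rmult_1_l; lra. }
  apply Rmult_le_reg_l with (a n); [easy|].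
  assert (a (S n) * (/ y * p (S n)) <= a (S n) * p (S (S n)))
    by (apply Rmult_le_compat_l; lra).
  assert (a (S n) * y * p (S n) <= a n * exp (Gamma a b n) * p (S n))
    by (apply Rmult_le_compat_r; lra).
  replace (a n * p n) with ((2 - b (S n)) * p (S n) - a (S n) * p (S (S n))) by lra.
  rewrite E; lra.
Qed.

Lemma unbounded_step_up (p : nat -> R) (n : nat) :
  is_lim_seq p p_infty -> exists k : nat, p (n + k)%nat <= p (S (n + k)).
Proof.
intros Hlim; apply NNPP; intros Hno.
assert (D : forall k, p (n + k)%nat <= p n).
{ induction k as [|k IH]; [rewrite Nat.add_0_r; lra|].
  rewrite Nat.add_succ_r.
  destruct (Rle_lt_dec (p (n + k)%nat) (p (S (n + k)))) as [Hle|Hlt]; [|lra].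
  now elim Hno; exists k. }
apply is_lim_seq_spec in Hlim; destruct (Hlim (p n)) as [m Hm].
specialize (Hm (n + m)%nat ltac:(lia)); specialize (D m); lra.
Qed.

(** The perturbation [v + e * u] tends to infinity, hence steps up somewhere beyond [n];
    there it trivially decays at most at rate [exp (Gamma a b n)], as this is at least 1.
    That carries back to [n], and [e] can be sent to 0. *)
Lemma recessive_ratio (a b u v : nat -> R) (N0 : nat)
  (ha : forall n : nat, (1 <= n)%nat -> 0 < a n) (hN0 : (1 <= N0)%nat)
  (hab : forall n : nat, (N0 <= n)%nat -> a n <= 1 /\ b n <= 0)
  (hmono : forall n : nat, (N0 <= n)%nat -> b n <= b (S n) /\ a n <= a (S n)) :
  real_eigensolution a b 2 u -> real_eigensolution a b 2 v ->
  (forall n : nat, (N0 <= n)%nat -> 0 <= u n /\ 0 <= v n) ->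
  is_lim_seq u p_infty ->
  forall n : nat, (N0 <= n)%nat -> v n <= exp (Gamma a b n) * v (S n).
Proof.
intros Hu Hv Hpos Hlim n Hn.
assert (P : forall e, 0 < e ->
          v n + e * u n <= exp (Gamma a b n) * (v (S n) + e * u (S n))).
{ intros e He.
  assert (HL : is_lim_seq (fun n => v n + e * u n) p_infty).
  { apply is_lim_seq_spec; intros K; apply is_lim_seq_spec in Hlim.
    destruct (Hlim (K / e)) as [m Hm]; exists (m + N0)%nat; intros k Hk.
    specialize (Hm k ltac:(lia)); destruct (Hpos k ltac:(lia)).
    apply Rmult_lt_compat_l with (r := e) in Hm; [|easy].
    replace (e * (K / e)) with K in Hm by (field; lra); lra. }
  destruct (unbounded_step_up _ n HL) as [k Hk].
  apply (slow_decay_backwards a b (fun n => v n + e * u n) N0 ha hN0 hab hmono)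
    with (k := k); [| |easy|].
  - intros m Hm; specialize (Hu m Hm); specialize (Hv m Hm); nra.
  - intros m Hm; destruct (Hpos m Hm); nra.
  - eapply Rle_trans; [exact Hk|].
    destruct (Hpos (S (n + k)) ltac:(lia)), (hab (n + k)%nat ltac:(lia)).
    pose proof (ha (n + k)%nat ltac:(lia)).
    pose proof (exp_Gamma_ge1 a b (n + k) ltac:(lra) ltac:(lra)).
    assert (0 <= v (S (n + k)) + e * u (S (n + k))) by nra.
    nra. }
set (y := exp (Gamma a b n)) in *.
pose proof (exp_pos (Gamma a b n)) as Hy; fold y in Hy.
destruct (Hpos (S n) ltac:(lia)), (Hpos n Hn).
apply le_epsilon; intros e He.
assert (Hd : 0 < y * u (S n) + 1) by nra.
specialize (P (e / (y * u (S n) + 1)) ltac:(apply Rdiv_lt_0_compat; lra)).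
assert (F : 0 < e / (y * u (S n) + 1)) by (apply Rdiv_lt_0_compat; lra).
assert (e / (y * u (S n) + 1) * (y * u (S n) + 1) = e) by (field; lra).
set (d := e / (y * u (S n) + 1)) in *.
nra.
Qed.

Lemma exp_sum_succ (G : nat -> R) (N0 n : nat) : (N0 <= S n)%nat ->
  exp (sum_n_m G N0 (S n)) = exp (sum_n_m G N0 n) * exp (G (S n)).
Proof. intros H; now rewrite sum_n_Sm, <- exp_plus by easy. Qed.

(** The factor [exp (G n)] on the right compensates the last factor of the product: [n - N0]
    steps lead from [N0] to [n], while the sum has one more term. *)
Lemma growing_product_bound (G u : nat -> R) (N0 : nat) :
  u N0 = 1 ->
  (forall n : nat, (N0 <= n)%nat -> exp (G n) * u n <= u (S n)) ->
  forall n : nat, (N0 <= n)%nat -> exp (sum_n_m G N0 n) <= exp (G n) * u n.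
Proof.
intros H0 H; induction 1 as [|n Hn IH].
- rewrite sum_n_n, H0; lra.
- rewrite exp_sum_succ by lia; specialize (H n Hn).
  pose proof (exp_pos (G (S n))); rewrite Rmult_comm.
  apply Rmult_le_compat_l; lra.
Qed.

Lemma decaying_product_bound (G v : nat -> R) (N0 : nat) :
  (forall n : nat, (N0 <= n)%nat -> v n <= exp (G n) * v (S n)) ->
  forall n : nat, (N0 <= n)%nat -> v N0 * exp (G n) <= v n * exp (sum_n_m G N0 n).
Proof.
intros H; induction 1 as [|n Hn IH].
- rewrite sum_n_n; lra.
- rewrite exp_sum_succ by lia; specialize (H n Hn).
  pose proof (exp_pos (G (S n))); pose proof (exp_pos (G n)).
  pose proof (exp_pos (sum_n_m G N0 n)).
  rewrite <- Rmult_assoc; apply Rmult_le_compat_r; [lra|].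
  apply Rmult_le_reg_r with (exp (G n)); [easy|].
  eapply Rle_trans; [exact IH|].
  apply Rle_trans with (exp (G n) * v (S n) * exp (sum_n_m G N0 n)); [|lra].
  apply Rmult_le_compat_r; lra.
Qed.

(** [u n] is 1 plus a sum of increments [flux a u k / a k], each of which is at most
    [flux a u n / a N0]; the 1 is itself bounded by such a term. *)
Lemma growing_le_flux (a u : nat -> R) (N0 : nat) :
  (1 <= N0)%nat -> 0 < a N0 -> u N0 = 1 ->
  (forall n : nat, (N0 <= n)%nat -> a N0 <= a n) ->
  (forall n : nat, (N0 <= n)%nat -> a N0 <= flux a u n <= flux a u (S n)) ->
  forall n : nat, (N0 <= n)%nat -> a N0 * u n <= INR n * flux a u n.
Proof.
intros hN0 HaN H0 Ha Hf; induction 1 as [|n Hn IH].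
- apply le_INR in hN0; simpl in hN0.
  specialize (Hf N0 (le_n _)); rewrite H0; nra.
- specialize (Ha n Hn); specialize (Hf n Hn).
  assert (a N0 * (u (S n) - u n) <= flux a u n).
  { unfold flux in *; apply Rmult_le_compat_r; nra. }
  rewrite S_INR; pose proof (pos_INR n); nra.
Qed.

Theorem theorem1 (a b : nat -> R)
  (ha : forall n : nat, (1 <= n)%nat -> 0 < a n)
  (habdd : bounded_real a) (hbbdd : bounded_real b)
  (N0 : nat) (hN0 : (1 <= N0)%nat)
  (hab : forall n : nat, (N0 <= n)%nat -> a n <= 1 /\ b n <= 0) :
  (exists v : nat -> C, subordinate a b 2 v /\ bounded_complex v) /\
  ((forall n : nat, (N0 <= n)%nat -> b n <= b (n + 1)%nat /\ a n <= a (n + 1)%nat) ->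
   is_lim_seq b 0 -> is_lim_seq a 1 ->
   forall v : nat -> C, subordinate a b 2 v ->
   exists (c : C) (w : nat -> R),
     c <> RtoC 0 /\
     (forall n : nat, (1 <= n)%nat -> RtoC (w n) = (c * v n)%C) /\
     exists C1 C2 : R, 0 < C1 /\ 0 < C2 /\
       forall n : nat, (N0 <= n)%nat ->
         C1 * / INR n * exp (- sum_n_m (Gamma a b) N0 n) <= w n /\
         w n <= C2 * INR n * exp (- sum_n_m (Gamma a b) N0 n)).
Proof.
pose proof (ha N0 hN0) as HaN; destruct (hab N0 (le_n _)) as [HaN1 HbN].
set (Y := exp (Gamma a b N0)).
assert (HY : 1 <= Y) by (apply exp_Gamma_ge1; lra).
(* The ratio [1 + Y] meets both requirements on the start: at least 2 and at least [Y]. *)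
destruct (growing_recessive_pair a b N0 ha hN0 hab (1 + Y) ltac:(lra))
  as (u & v & Hu & Hv & Hu0 & Hu1 & Gr & Hvn & Hbd & Hsub).
split; [now exists (fun n => RtoC (v n))|].
intros hmono0 _ _ v' Hv'.
assert (hmono : forall n, (N0 <= n)%nat -> b n <= b (S n) /\ a n <= a (S n)).
{ intros n Hn; specialize (hmono0 n Hn); now rewrite Nat.add_1_r in hmono0. }
destruct (subordinate_unique a b 2 v' _ Hv' Hsub) as (c & Hc & Ec).
exists c, v; split; [easy|split; [easy|]].
assert (Hlim : is_lim_seq u p_infty).
{ apply growing_solution_lim with N0 (a N0); [easy|].
  intros n Hn; now destruct (Gr n Hn). }
assert (Hup : forall n, (N0 <= n)%nat -> exp (Gamma a b n) * u n <= u (S n)).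
{ apply (growing_ratio a b u N0); auto.
  - intros n Hn; destruct (Gr n Hn); lra.
  - rewrite Hu0, Hu1; fold Y; lra. }
assert (Hdown : forall n, (N0 <= n)%nat -> v n <= exp (Gamma a b n) * v (S n)).
{ apply (recessive_ratio a b u v N0); auto.
  intros n Hn; destruct (Gr n Hn), (Hvn n Hn); lra. }
assert (Hinit : forall n, (N0 <= n)%nat -> a N0 <= a n /\ exp (Gamma a b n) <= Y).
{ induction 1 as [|n Hn [IH1 IH2]]; [split; apply Rle_refl|].
  pose proof (ha n ltac:(lia)); pose proof (ha (S n) ltac:(lia)).
  destruct (hab n Hn), (hab (S n) ltac:(lia)), (hmono n Hn).
  destruct (exp_Gamma_decreasing a b n); lra. }
exists (v N0), (Y / a N0); destruct (Hvn N0 (le_n _)) as [HvN _].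
split; [easy|split; [apply Rdiv_lt_0_compat; lra|]].
intros n Hn.
pose proof (growing_product_bound _ u N0 Hu0 Hup n Hn) as B1.
pose proof (decaying_product_bound _ v N0 Hdown n Hn) as B2.
destruct (Hvn n Hn) as [V0 V1], (Gr n Hn) as (G1 & G2 & _), (hab n Hn), (Hinit n Hn) as [_ I2].
pose proof (exp_Gamma_ge1 a b n ltac:(pose proof (ha n ltac:(lia)); lra) ltac:(lra)).
pose proof (exp_pos (sum_n_m (Gamma a b) N0 n)) as E0.
assert (HN : 1 <= INR n) by (apply (le_INR 1); lia).
rewrite exp_Ropp; set (E := exp (sum_n_m (Gamma a b) N0 n)) in *.
split; apply Rmult_le_reg_r with E; try easy;
  rewrite Rmult_assoc, Rinv_l, Rmult_1_r by lra.
- apply Rle_trans with (v N0); [|nra].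
  rewrite <- (Rmult_1_r (v N0)) at 2; apply Rmult_le_compat_l; [lra|].
  rewrite <- Rinv_1; apply Rinv_le_contravar; lra.
- pose proof (growing_le_flux a u N0 hN0 HaN Hu0
    (fun k Hk => proj1 (Hinit k Hk))
    (fun k Hk => proj1 (proj2 (Gr k Hk))) n Hn) as B3.
  apply Rle_trans with (/ flux a u n * (Y * u n)).
  { apply Rmult_le_compat; try lra.
    eapply Rle_trans; [exact B1|apply Rmult_le_compat_r; lra]. }
  apply Rmult_le_reg_l with (flux a u n * a N0); [apply Rmult_lt_0_compat; lra|].
  replace (flux a u n * a N0 * (/ flux a u n * (Y * u n)))
    with (Y * (a N0 * u n)) by (field; lra).
  replace (flux a u n * a N0 * (Y / a N0 * INR n))
    with (Y * (INR n * flux a u n)) by (field; lra).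
  apply Rmult_le_compat_l; lra.
Qed.
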